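(* Let $\theta\ge2$ be an integer. For $i=1,2$, let $X_{n,i}^{(\theta)}$ be the number of vertices contained in exactly $i$ hyperedges in a hyperrecursive tree with parameter $\theta$ at age $n$, and let $\mathbf\Sigma_n$ be the $2\times2$ covariance matrix of $(X_{n,1}^{(\theta)},X_{n,2}^{(\theta)})$. Then, as $n\to\infty$ (entrywise), $$\frac1n\mathbf\Sigma_n\to\begin{pmatrix}\dfrac{(\theta-1)^2}{\theta^2(2\theta-1)} & -\dfrac{(\theta-1)^2(\theta^2+2\theta-1)}{\theta^3(2\theta-1)^2}\\[3mm] -\dfrac{(\theta-1)^2(\theta^2+2\theta-1)}{\theta^3(2\theta-1)^2} & \dfrac{(\theta-1)^2(6\theta^4-6\theta^3+8\theta^2-5\theta+1)}{\theta^4(2\theta-1)^3}\end{pmatrix}.$$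
   Context: Hyperrecursive tree with parameter (hyperedge size) $\theta$ (an integer $\theta\ge2$): at time $0$ there are $\theta$ originating vertices, all labeled $0$, which together form the first hyperedge. At each time $n\ge1$ a new vertex labeled $n$ is added; a subset of size $\theta-1$ of the $n-1+\theta$ existing vertices is chosen uniformly at random among all subsets of that size (independently of the past), and the new vertex together with the chosen vertices forms a new hyperedge. The structure at time $n$ (right after insertion of vertex $n$) is said to have age $n$. All vertices, including each of the $\theta$ originators, are counted in $X_{n,i}^{(\theta)}$; in particular $X_{0,1}^{(\theta)}=\theta$ and $X_{0,2}^{(\theta)}=0$. *)

(* Defs.v *)
From HB Require Import structures.
From mathcomp Require Import all_boot all_order all_algebra finmap.
From mathcomp Require Import all_classical all_reals all_analysis.

Set Implicit Arguments.
Unset Strict Implicit.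
Unset Printing Implicit Defensive.

Import Order.TTheory GRing.Theory Num.Theory.
Import numFieldNormedType.Exports.

Local Open Scope classical_set_scope.
Local Open Scope ring_scope.

(* Encoding of the vertices as natural numbers: the theta originators (all     *)
(* labeled 0) are 0, ..., theta - 1, and the vertex labeled n >= 1 is          *)
(* n - 1 + theta.                                                              *)
Definition vertices (theta n : nat) : {fset nat} :=
  [fset v in iota 0 (n + theta)]%fset.

(* The admissible choices for the insertion of the vertex labeled n + 1.       *)
Definition choices (theta n : nat) : {fset {fset nat}} :=
  [fset A in fpowerset (vertices theta n) | #|` A| == theta.-1]%fset.

(* c k is the set chosen at time k + 1; hyperedge theta c j is the hyperedge   *)
(* created at time j.                                                          *)
Definition hyperedge (theta : nat) (c : nat -> {fset nat}) (j : nat)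
    : {fset nat} :=
  if j is k.+1 then ((k + theta)%N |` c k)%fset else vertices theta 0.

(* Counting the hyperedges by their time of creation is the same as counting   *)
(* them as sets: as soon as every c k is in choices theta k, they are pairwise *)
(* distinct, because hyperedge k + 1 contains k + theta and no earlier         *)
(* hyperedge does.                                                             *)
Definition degree (theta : nat) (c : nat -> {fset nat}) (n v : nat) : nat :=
  #|[set j : 'I_n.+1 | v \in hyperedge theta c j]%SET|.

Definition num_vertices_of_degree (theta : nat) (c : nat -> {fset nat})
    (n i : nat) : nat :=
  #|` [fset v in vertices theta n | degree theta c n v == i]%fset|.

Definition past (T : Type) (C : nat -> T -> {fset nat}) (n : nat) (w : T)
    : seq {fset nat} :=
  [seq C k w | k <- iota 0 n].

(* The random sets take values in a countable type, equipped with its discrete *)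
(* sigma-algebra: every B : set {fset nat} and every B : set (seq {fset nat})  *)
(* is an event for the value of C n and of past C n, respectively.             *)
Record hyperrecursive_tree (d : measure_display) (T : measurableType d)
    (R : realType) (P : probability T R) (theta : nat)
    (C : nat -> T -> {fset nat}) : Prop := HyperrecursiveTree {
  choice_measurable : forall (n : nat) (B : set {fset nat}),
    measurable (C n @^-1` B);
  choice_uniform : forall (n : nat) (A : {fset nat}),
    P (C n @^-1` [set A]) =
      ((A \in choices theta n)%:R / #|` choices theta n|%:R)%:E;
  choice_indep_past : forall (n : nat) (B : set (seq {fset nat}))
      (D : set {fset nat}),
    P (past C n @^-1` B `&` C n @^-1` D) =
      (P (past C n @^-1` B) * P (C n @^-1` D))%E
}.

Definition X (T : Type) (R : realType) (theta : nat)
    (C : nat -> T -> {fset nat}) (n i : nat) : T -> R :=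
  fun w => (num_vertices_of_degree theta (fun k => C k w) n i)%:R.

(* fine loses nothing here: X theta C n i is bounded by n + theta, hence its   *)
(* covariances are finite. The indices 0, 1 : 'I_2 stand for i = 1, 2.         *)
Definition covariance_matrix (d : measure_display) (T : measurableType d)
    (R : realType) (P : probability T R) (theta : nat)
    (C : nat -> T -> {fset nat}) (n : nat) : 'M[R]_2 :=
  \matrix_(i < 2, j < 2)
    fine (covariance P (X R theta C n i.+1) (X R theta C n j.+1)).

Definition mx2 (R : Type) (a b c d : R) : 'M[R]_2 :=
  \matrix_(i < 2, j < 2)
    if i == 0 then (if j == 0 then a else b) else (if j == 0 then c else d).

Definition limit_matrix (R : realType) (theta : nat) : 'M[R]_2 :=
  let t : R := theta%:R in
  mx2
    ((t - 1) ^+ 2 / (t ^+ 2 * (2 * t - 1)))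
    (- ((t - 1) ^+ 2 * (t ^+ 2 + 2 * t - 1) / (t ^+ 3 * (2 * t - 1) ^+ 2)))
    (- ((t - 1) ^+ 2 * (t ^+ 2 + 2 * t - 1) / (t ^+ 3 * (2 * t - 1) ^+ 2)))
    ((t - 1) ^+ 2 * (6 * t ^+ 4 - 6 * t ^+ 3 + 8 * t ^+ 2 - 5 * t + 1)
       / (t ^+ 4 * (2 * t - 1) ^+ 3)).

(* Main.v *)
(* Given the past up to age n, the inserted vertex chooses a uniform subset of
   size k = theta - 1 of the n + theta vertices, so if X1 and X2 count the vertices
   of degree 1 and 2 and J1, J2 those among them that are not chosen, the new
   counts are J1 + 1 and J2 + X1 - J1. The first two conditional moments of J1, J2
   are linear in those of X1, X2, with coefficients built from the probabilities
   q1 and q2 that one, respectively two, given vertices are missed. The means and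
   the centred second moments thus satisfy a triangular system of recursions
   x (n+1) = r n * x n + e n with r = q1 or q2 and n (1 - r n) --> c (c = k or 2k);
   such a sequence grows like n * lim e / (1 + c). Since n (q1 - q2) --> k and
   n^2 (q2 - q1^2) --> - k, the limits of e are found one after the other. *)
Require Import Defs.
From HB Require Import structures.
From mathcomp Require Import all_boot all_order all_algebra finmap.
From mathcomp Require Import all_classical all_reals all_analysis.
From mathcomp Require Import measurable_realfun ring.

Set Implicit Arguments.
Unset Strict Implicit.
Unset Printing Implicit Defensive.

Import Order.TTheory GRing.Theory Num.Theory.
Import numFieldNormedType.Exports.

Local Open Scope classical_set_scope.
Local Open Scope ring_scope.

(** * Uniform k-subsets *)

Definition draws (K : choiceType) (V : {fset K}) (k : nat) : {fset {fset K}} :=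
  [fset A in fpowerset V | #|` A| == k]%fset.

Lemma in_draws (K : choiceType) (V : {fset K}) (k : nat) (A : {fset K}) :
  (A \in draws V k) = (A `<=` V)%fset && (#|` A| == k).
Proof. by rewrite !inE fpowersetE. Qed.

Lemma card_fsetval (K : choiceType) (V : {fset K}) (Y : {set V}) :
  #|` [fsetval y in Y]%fset| = #|Y|.
Proof.
by rewrite card_imfset /= ?cardE //; exact: val_inj.
Qed.

(** The count is transported to the finite type [{set V}], where the number of k-subsets is a known
    binomial, along the injection [f] of sets over [V] into finite sets. *)
Lemma card_fdraws (K : choiceType) (V : {fset K}) (k : nat) :
  #|` draws V k| = 'C(#|` V|, k).
Proof.
pose f (Y : {set V}) : {fset K} := [fsetval y in Y]%fset.
have f_inj : injective f.
  by move=> Y Z /fsetP YZ; apply/setP => x; have := YZ (val x); rewrite !inE.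
have -> : draws V k = [fset f Y | Y in [set Y : {set V} | #|Y| == k]%SET]%fset.
  apply/fsetP => A; rewrite in_draws; apply/andP/imfsetP => [[AV Ak]|[Y]] /=.
    exists (fsub _ A); last by rewrite /f fsubK.
    by rewrite inE -(eqP Ak) -card_fsetval fsubK.
  rewrite inE => Yk ->; split; last by rewrite card_fsetval.
  by apply/fsubsetP => x /in_fset_valP [].
by rewrite card_imfset //= -cardE card_draws cardfE.
Qed.

Definition mean (R : numFieldType) (T : Type) (s : seq T) (f : T -> R) : R :=
  (\sum_(x <- s) f x) / (size s)%:R.

Section mean.
Context {R : numFieldType} {T : eqType}.
Implicit Types (s : seq T) (f g : T -> R).

Lemma eq_mean s f g : {in s, f =1 g} -> mean s f = mean s g.
Proof. by move=> fg; rewrite /mean; congr (_ / _); exact: eq_big_seq. Qed.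

Lemma meanD s f g : mean s (fun x => f x + g x) = mean s f + mean s g.
Proof. by rewrite /mean big_split mulrDl. Qed.

Lemma meanZ s (a : R) f : mean s (fun x => a * f x) = a * mean s f.
Proof. by rewrite /mean -big_distrr /= mulrA. Qed.

Lemma meanB s f g : mean s (fun x => f x - g x) = mean s f - mean s g.
Proof.
by rewrite -[in RHS]mulN1r -meanZ -meanD; apply: eq_mean => x _; rewrite mulN1r.
Qed.

Lemma mean_sum s (I : Type) (r : seq I) (F : I -> T -> R) :
  mean s (fun x => \sum_(i <- r) F i x) = \sum_(i <- r) mean s (F i).
Proof. by rewrite /mean exchange_big /= big_distrl. Qed.

Lemma big_sum_cst (I : Type) (r : seq I) (a : R) :
  \sum_(i <- r) a = a * (size r)%:R.
Proof. by rewrite big_const_seq count_predT iter_addr_0 mulr_natr. Qed.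

Lemma mean_cst s (a : R) : (0 < size s)%N -> mean s (fun=> a) = a.
Proof.
move=> s0; by rewrite /mean big_sum_cst mulfK // pnatr_eq0 -lt0n.
Qed.

End mean.

Section hypergeometric.
Context {R : numFieldType} {K : choiceType}.
Implicit Types (V D E : {fset K}).

(** For [2 <= N] and [k < N] these are the ratios of ['C(N - 1, k)] and ['C(N - 2, k)] to
    ['C(N, k)]. When [k = N - 1] the factor [N.-1 - k] is 0, as it should be: such a set cannot miss
    two elements. *)
Definition miss1 (N k : nat) : R := (N - k)%:R / N%:R.
Definition miss2 (N k : nat) : R :=
  ((N - k) * (N.-1 - k))%:R / (N * N.-1)%:R.

Lemma sum_fset_natr (I : choiceType) (A : {fset I}) (B : pred I) :
  \sum_(i <- A) (B i)%:R = #|` [fset i in A | B i]%fset|%:R :> R.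
Proof.
rewrite -sum1_size natr_sum -(big_fset_condE _ A B (fun=> 1%:R)) [RHS]big_mkcond /=.
by apply: eq_bigr => i _; case: ifP.
Qed.

Lemma mean_draws_disjoint V k (B : {fset K}) :
  mean (draws V k) (fun A => ([disjoint A & B]%fset)%:R)
    = ('C(#|` (V `\` B)%fset|, k))%:R / ('C(#|` V|, k))%:R :> R.
Proof.
rewrite /mean card_fdraws; congr (_ / _).
rewrite sum_fset_natr -card_fdraws; congr (#|` _|%:R).
by apply/fsetP => A; rewrite in_fset /= !inE !fpowersetE fsubsetD andbAC.
Qed.

Lemma mean_draws_notin V k (v : K) : (k < #|` V|)%N -> v \in V ->
  mean (draws V k) (fun A => (v \notin A)%:R) = miss1 #|` V| k.
Proof.
move=> kV vV; under eq_mean do rewrite -fdisjointX1.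
rewrite mean_draws_disjoint cardfsDS ?fsub1set // cardfs1 subn1 /miss1.
have N0 : (0 < #|` V|)%N by exact: leq_trans kV.
apply/eqP; rewrite eqr_div ?pnatr_eq0 -?lt0n ?bin_gt0 ?(ltnW kV) //.
by rewrite -!natrM -mul_bin_down mulnC.
Qed.

Lemma mean_draws_notin2 V k (u v : K) : (k < #|` V|)%N ->
  u \in V -> v \in V -> u != v ->
  mean (draws V k) (fun A => (u \notin A)%:R * (v \notin A)%:R) = miss2 #|` V| k.
Proof.
move=> kV uV vV uv.
have uvV : ([fset u; v] `<=` V)%fset by rewrite fsubUset !fsub1set uV.
have N1 : (1 < #|` V|)%N.
  (* [cardfs2] gives the cardinality [(u != v).+1] with the boolean read as a number, so 2 is first
     written [true.+1]. *)
  by rewrite -[2%N]/(true.+1) -uv -cardfs2; exact: fsubset_leq_card.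
under eq_mean => A _.
  rewrite -natrM mulnb -!fdisjointX1 -fdisjointXU.
over.
rewrite mean_draws_disjoint cardfsDS // cardfs2 uv /miss2.
have N0 : (0 < #|` V|)%N by exact: ltnW.
have N2 : (0 < #|` V|.-1)%N by rewrite -ltnS prednK.
apply/eqP; rewrite eqr_div ?pnatr_eq0 -?lt0n ?bin_gt0 ?muln_gt0 ?(ltnW kV) ?N0 //.
(* The absorption identity [N * 'C(N.-1, k) = (N - k) * 'C(N, k)] is used twice, first at [N.-1] and
   then at [N]. *)
rewrite -!natrM subn2 mulnC -mulnA mul_bin_down mulnCA mul_bin_down.
by apply/eqP; congr _%:R; rewrite !mulnA; congr (_ * _)%N; rewrite mulnC.
Qed.

Lemma natr_cardfsD D (A : {fset K}) :
  #|` (D `\` A)%fset|%:R = \sum_(v <- D) (v \notin A)%:R :> R.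
Proof.
rewrite sum_fset_natr; congr (#|` _|%:R).
by apply/fsetP => v; rewrite !inE andbC.
Qed.

Lemma mean_draws_cardD V k D : (k < #|` V|)%N -> (D `<=` V)%fset ->
  mean (draws V k) (fun A => #|` (D `\` A)%fset|%:R)
    = miss1 #|` V| k * #|` D|%:R.
Proof.
move=> kV /fsubsetP DV; under eq_mean do rewrite natr_cardfsD.
rewrite mean_sum (eq_big_seq (fun=> miss1 #|` V| k)) => [|v /DV vV].
  by rewrite big_sum_cst.
exact: mean_draws_notin.
Qed.

(** The product is a sum over pairs [u] in [D], [v] in [E]. Both are missed with probability [miss2]
    if [u != v] and [miss1] if [u = v], so every pair contributes [miss2] and each element of the
    intersection adds the excess [miss1 - miss2]. *)
Lemma mean_draws_cardDM V k D E : (k < #|` V|)%N ->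
  (D `<=` V)%fset -> (E `<=` V)%fset ->
  mean (draws V k) (fun A => #|` (D `\` A)%fset|%:R * #|` (E `\` A)%fset|%:R)
    = miss2 #|` V| k * (#|` D|%:R * #|` E|%:R)
      + (miss1 #|` V| k - miss2 #|` V| k) * #|` (D `&` E)%fset|%:R.
Proof.
move=> kV /fsubsetP DV /fsubsetP EV.
under eq_mean => A _.
  rewrite !natr_cardfsD big_distrl /=.
  under eq_bigr do rewrite big_distrr /=.
over.
rewrite mean_sum; under eq_bigr do rewrite mean_sum.
set q1 := miss1 _ _; set q2 := miss2 _ _.
rewrite (eq_big_seq (fun u => q2 * #|` E|%:R + (q1 - q2) * (u \in E)%:R)).
  rewrite big_split /= big_sum_cst.
  rewrite -big_distrr /= -mulrA [#|` E|%:R * _]mulrC; congr (_ + _ * _).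
  rewrite sum_fset_natr; congr (#|` _|%:R).
  by apply/fsetP => v; rewrite !inE.
move=> u /DV uV.
rewrite (eq_big_seq (fun v => q2 + (q1 - q2) * (u == v)%:R)).
  rewrite big_split /= big_sum_cst.
  rewrite -big_distrr /=; congr (_ + _ * _).
  have [uE|uE] := boolP (u \in E).
    rewrite (big_fsetD1 u) //= eqxx big1_fset ?addr0 // => v; rewrite !inE.
    by case: (eqVneq v u).
  rewrite big1_seq // => v /andP[_ vE]; case: eqVneq => // uv.
  by rewrite -uv (negPf uE) in vE.
move=> v /EV vV; have [<-|uv] := eqVneq u v.
  rewrite mulr1 addrC subrK /q1 -(mean_draws_notin kV uV).
  by apply: eq_mean => A _; case: (u \notin A); rewrite ?mulr1 ?mulr0.
by rewrite mulr0 addr0 mean_draws_notin2.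
Qed.

End hypergeometric.

(** * Effect of one insertion on the degrees *)

Section one_step.
Variable theta : nat.
Implicit Types (c : nat -> {fset nat}) (v : nat).

Definition level c (n i : nat) : {fset nat} :=
  [fset v in vertices theta n | degree theta c n v == i]%fset.

Lemma in_vertices n v : (v \in vertices theta n) = (v < n + theta)%N.
Proof. by rewrite in_fset /= mem_iota. Qed.

Lemma card_vertices n : #|` vertices theta n| = (n + theta)%N.
Proof. by rewrite card_fseq undup_id ?iota_uniq // size_iota. Qed.

Lemma in_level c n i v :
  (v \in level c n i) = (v < n + theta)%N && (degree theta c n v == i).
Proof. by rewrite in_fset /= inE in_vertices. Qed.

Lemma level_sub c n i : (level c n i `<=` vertices theta n)%fset.
Proof. by apply/fsubsetP => v; rewrite in_level in_vertices => /andP[]. Qed.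

Lemma level_disjoint c n i j : i != j -> (level c n i `&` level c n j)%fset = fset0.
Proof.
move=> ij; apply/fsetP => v; rewrite in_fsetI !in_level in_fset0.
by case: eqVneq => [->|]; rewrite ?(negPf ij) ?andbF.
Qed.

Lemma degreeE c n v :
  degree theta c n v = (\sum_(j < n.+1) (v \in hyperedge theta c j))%N.
Proof.
rewrite /degree -sum1_card big_mkcond /=; apply: eq_bigr => j _.
by rewrite inE; case: ifP.
Qed.

Lemma degree0 c v : degree theta c 0 v = (v < theta)%N.
Proof. by rewrite degreeE big_ord1 /= in_vertices. Qed.

Lemma degreeS c n v : degree theta c n.+1 v
  = (degree theta c n v + ((v == n + theta)%N || (v \in c n)))%N.
Proof. by rewrite !degreeE big_ord_recr /= in_fset1U. Qed.

Lemma eq_degree c c' n v : (forall k, (k < n)%N -> c k = c' k) ->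
  degree theta c n v = degree theta c' n v.
Proof.
elim: n => [|n IHn] cc'; first by rewrite !degree0.
by rewrite !degreeS cc' // IHn // => k kn; rewrite cc' // ltnW.
Qed.

(** This allows the process to be replaced by [nth fset0 s] for a history [s] of length [n]: at age
    [n] the default value is never read. *)
Lemma eq_level c c' n i : (forall k, (k < n)%N -> c k = c' k) ->
  level c n i = level c' n i.
Proof.
by move=> cc'; apply/fsetP => v; rewrite !in_level (eq_degree v cc').
Qed.

Lemma degree_gt0 c n v : (v < n + theta)%N -> (0 < degree theta c n v)%N.
Proof.
elim: n => [|n IHn]; first by rewrite degree0 add0n => ->.
rewrite addSn ltnS leq_eqVlt degreeS => /predU1P[->|/IHn]; first by rewrite eqxx addn1.
by move=> /leq_trans; apply; exact: leq_addr.
Qed.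

Lemma degree_eq0 c n v : (forall k, (k < n)%N -> (c k `<=` vertices theta k)%fset) ->
  (n + theta <= v)%N -> degree theta c n v = 0%N.
Proof.
elim: n => [|n IHn] cV nv; first by rewrite degree0 ltnNge nv.
rewrite degreeS IHn => [|k kn|]; last 2 first.
- by rewrite cV // ltnW.
- exact: ltnW.
rewrite gtn_eqF //; case: (boolP (v \in c n)) => // /(fsubsetP (cV n (ltnSn n))).
by rewrite in_vertices ltnNge ltnW.
Qed.

Section choice.
Variables (c : nat -> {fset nat}) (n : nat).
Hypothesis cV : forall k, (k <= n)%N -> (c k `<=` vertices theta k)%fset.

Let degree_new : degree theta c n (n + theta)%N = 0%N.
Proof. by apply: degree_eq0 => // k /ltnW; exact: cV. Qed.

(** An old vertex has positive degree, so being chosen lifts it to degree at least 2; the only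
    vertex entering level 1 is the inserted one. *)
Lemma level1S : level c n.+1 1 = ((n + theta)%N |` (level c n 1 `\` c n))%fset.
Proof.
apply/fsetP => v; rewrite in_fset1U in_fsetD !in_level degreeS addSn ltnS.
rewrite leq_eqVlt; case: eqVneq => /= [->|vn].
  by rewrite degree_new.
case: (ltnP v (n + theta)%N) => /= [vlt|]; last by rewrite andbF.
have := degree_gt0 c vlt.
by case: (v \in c n) => //=; case: degree => [|[|]].
Qed.

Lemma level2S : level c n.+1 2
  = ((level c n 2 `\` c n) `|` (level c n 1 `&` c n))%fset.
Proof.
apply/fsetP => v; rewrite in_fsetU in_fsetD in_fsetI !in_level degreeS addSn ltnS.
rewrite leq_eqVlt; case: eqVneq => /= [->|vn].
  by rewrite degree_new ltnn andbF.
case: (ltnP v (n + theta)%N) => /= [vlt|]; last by rewrite andbF.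
by case: (v \in c n); rewrite /= ?addn1 ?eqSS ?andbT // addn0 andbF orbF.
Qed.

Lemma card_level1S :
  #|` level c n.+1 1| = #|` (level c n 1 `\` c n)%fset|.+1.
Proof.
by rewrite level1S cardfsU1 in_fsetD in_level ltnn andbF.
Qed.

(** The chosen vertices of degree 1 enter level 2. Adding the unchosen ones to both sides avoids a
    subtraction of natural numbers. *)
Lemma card_level2S : (#|` level c n.+1 2| + #|` (level c n 1 `\` c n)%fset|
  = #|` (level c n 2 `\` c n)%fset| + #|` level c n 1|)%N.
Proof.
rewrite level2S cardfsU.
rewrite (_ : (level c n 2 `\` c n) `&` _ = fset0)%fset; last first.
  apply/fsetP => v; rewrite in_fset0 !in_fsetI in_fsetD.
  by case: (v \in c n); rewrite ?andbF.
by rewrite cardfs0 subn0 -addnA cardfsID.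
Qed.

End choice.
End one_step.

(** * The law of the past *)

(** These are the pasts of positive probability, newest choice last as in [past]. The number of
    continuations of a history depends only on its length, so the past is uniform on this list. *)
Fixpoint histories (theta n : nat) : seq (seq {fset nat}) :=
  if n is m.+1 then
    [seq rcons s A | s <- histories theta m, A <- choices theta m]
  else [:: [::]].

Section histories.
Variable theta : nat.

Lemma choicesE n : choices theta n = draws (vertices theta n) theta.-1.
Proof. by []. Qed.

Lemma choices_gt0 n : (0 < size (choices theta n))%N.
Proof.
rewrite -[size _]/(#|` draws _ _|) card_fdraws card_vertices bin_gt0.
by rewrite (leq_trans (leq_pred _)) ?leq_addl.
Qed.

Lemma size_historiesS n :
  size (histories theta n.+1) = (size (histories theta n) * size (choices theta n))%N.
Proof. by rewrite size_allpairs. Qed.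

Lemma histories_gt0 n : (0 < size (histories theta n))%N.
Proof.
by elim: n => // n IHn; rewrite size_historiesS muln_gt0 IHn choices_gt0.
Qed.

Lemma uniq_histories n : uniq (histories theta n).
Proof.
elim: n => // n IHn; apply: allpairs_uniq => //.
by move=> [s A] [s' A'] _ _ /= /rcons_inj[-> ->].
Qed.

Lemma size_history n s : s \in histories theta n -> size s = n.
Proof.
elim: n s => [|n IHn] s; first by rewrite inE => /eqP ->.
by case/allpairsP => -[s' A] /= [/IHn ss' _ ->]; rewrite size_rcons ss'.
Qed.

Lemma nth_history n s k : s \in histories theta n -> (k < n)%N ->
  nth fset0 s k \in choices theta k.
Proof.
elim: n s => [|n IHn] s //.
case/allpairsP => -[s' A] /= [s'n An ->]; rewrite ltnS leq_eqVlt nth_rcons.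
rewrite (size_history s'n) => /predU1P[->|kn]; first by rewrite ltnn eqxx.
by rewrite kn IHn.
Qed.

(** This is the tower rule: the inner mean is the conditional expectation given the history [s]. The
    weights agree because all histories have equally many continuations. *)
Lemma mean_historiesS (R : numFieldType) n (f : seq {fset nat} -> R) :
  mean (histories theta n.+1) f =
  mean (histories theta n) (fun s => mean (choices theta n) (fun A => f (rcons s A))).
Proof.
rewrite /mean size_historiesS big_allpairs_dep natrM invfM mulrA mulrAC; congr (_ * _).
by rewrite big_distrl.
Qed.

End histories.

Section past.
Context {d : measure_display} {T : measurableType d} {R : realType}.
Variables (P : probability T R) (theta : nat) (C : nat -> T -> {fset nat}).
Hypothesis treeC : hyperrecursive_tree P theta C.

Lemma pastS n w : past C n.+1 w = rcons (past C n w) (C n w).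
Proof. by rewrite /past -addn1 iotaD map_cat cats1 add0n. Qed.

(** The event is split according to the value of the last choice, which ranges over a countable
    type. *)
Lemma measurable_past n (B : set (seq {fset nat})) : measurable (past C n @^-1` B).
Proof.
elim: n B => [|n IHn] B.
  rewrite (_ : _ @^-1` _ = if `[< B [::] >] then setT else set0).
    by case: ifP.
  by apply/seteqP; split => w; rewrite /past /=; case: asboolP.
rewrite (_ : _ @^-1` _ = \bigcup_(A : {fset nat})
    (past C n @^-1` [set s | B (rcons s A)] `&` C n @^-1` [set A])).
  apply: countable_bigcupT_measurable => [|A]; first exact: countableP.
  apply: measurableI; first exact: IHn.
  exact: (choice_measurable treeC).
apply/seteqP; split => w; rewrite /preimage /= pastS.
  by move=> Bw; exists (C n w).
by move=> [A _ [/= BA ->]].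
Qed.

Lemma past_uniform n s : s \in histories theta n ->
  P (past C n @^-1` [set s]) = ((size (histories theta n))%:R^-1)%:E.
Proof.
elim: n s => [|n IHn] s.
  rewrite inE => /eqP ->; rewrite (_ : _ @^-1` _ = setT) ?probability_setT ?invr1 //.
  by apply/seteqP; split.
case/allpairsP => -[s' A] /= [s'n An ->].
rewrite (_ : _ @^-1` _ = past C n @^-1` [set s'] `&` C n @^-1` [set A]).
  rewrite (choice_indep_past treeC) IHn // (choice_uniform treeC) An -EFinM.
  by rewrite [in RHS]size_allpairs natrM invfM mul1r.
apply/seteqP; split => w; rewrite /preimage /= pastS.
  by move=> /rcons_inj[-> ->].
by move=> [-> ->].
Qed.

(** The events that the past equals a given history are disjoint, and their finitely many masses
    already sum to 1. *)
Lemma past_histories n : {ae P, forall w, past C n w \in histories theta n}.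
Proof.
exists (~` (past C n @^-1` [set` histories theta n])); split => //.
  by apply: measurableC; exact: measurable_past.
rewrite probability_setC; last exact: measurable_past.
rewrite (_ : _ @^-1` _ = \bigcup_(s in [set` histories theta n]) past C n @^-1` [set s]).
  rewrite measure_fin_bigcup //=; last 2 first.
  - by move=> s s' _ _ [w [/= <- <-]].
  - by move=> s _; exact: measurable_past.
  rewrite -fsbig_seq ?uniq_histories // (eq_big_seq _ (@past_uniform n)).
  rewrite sumEFin big_sum_cst mulVf.
    by rewrite subee.
  by rewrite pnatr_eq0 -lt0n histories_gt0.
apply/seteqP; split => [w hw|w [s hs ws]]; first by exists (past C n w).
by move: hs; rewrite -(ws : past C n w = s).
Qed.

Lemma expectation_past n (f : seq {fset nat} -> R) :
  'E_P[fun w => f (past C n w)]%E = (mean (histories theta n) f)%:E.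
Proof.
have mpast s : measurable (past C n @^-1` [set s]) by exact: measurable_past.
rewrite unlock.
(* Off a null set the past is a history, so the integrand coincides with a finite combination of
   indicators and is integrated term by term. *)
rewrite (ae_eq_integral (fun w => \sum_(s <- histories theta n)
  (f s)%:E * (\1_(past C n @^-1` [set s]) w)%:E)%E) //; last 3 first.
- apply/measurable_EFinP => _ Y mY; rewrite setTI.
  exact: (@measurable_past n (f @^-1` Y)).
- apply: emeasurable_sum => s; apply: emeasurable_funM; first exact: measurable_cst.
  by apply/measurable_EFinP; exact: measurable_indic.
- apply: filterS (@past_histories n) => w hw _.
  rewrite (bigD1_seq (past C n w)) ?uniq_histories //= indicE mem_set // mule1.
  rewrite big1 ?adde0 // => s sw; rewrite indicE memNset ?mule0 // => /esym/eqP.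
  exact/negP.
have iind s : P.-integrable setT (fun w => (\1_(past C n @^-1` [set s]) w)%:E).
  exact: integrable_indic.
rewrite integral_sum // => [|s]; last exact: integrableZl.
rewrite /mean mulrC big_distrr -sumEFin; apply: eq_big_seq => s hs.
rewrite integralZl // integral_indic // setIT.
rewrite [RHS]EFinM [RHS]muleC; congr (_ * _)%E.
exact: past_uniform.
Qed.

End past.

(** * Recursions for the moments *)

Section moments.
Context {R : realType}.
Variable theta : nat.
Hypothesis theta_ge2 : (2 <= theta)%N.

Definition level_size (n i : nat) (s : seq {fset nat}) : R :=
  #|` level theta (nth fset0 s) n i|%:R.

(* The vertices missed by the chosen set [A] are counted, rather than those in
   [A], because the k-subsets of V avoiding B are the k-subsets of V minus B. *)
Definition unhit_size (n i : nat) (s : seq {fset nat}) (A : {fset nat}) : R :=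
  #|` (level theta (nth fset0 s) n i `\` A)%fset|%:R.

(** The moments are finite averages over histories, which keeps the recursions free of measure
    theory; [covariance_matrixE] links them to the probability space. *)
Definition moment1 (n i : nat) : R := mean (histories theta n) (level_size n i).

Definition moment2 (n i j : nat) : R :=
  mean (histories theta n) (fun s => level_size n i s * level_size n j s).

Definition cov (n i j : nat) : R := moment2 n i j - moment1 n i * moment1 n j.

Local Notation L := level_size.
Local Notation J := unhit_size.

Let q1 n : R := miss1 (n + theta) theta.-1.
Let q2 n : R := miss2 (n + theta) theta.-1.

(** The covariance on the probability space unfolds to a centred product, whereas the recursions
    come from raw second moments. *)
Lemma covE n i j : cov n i j = mean (histories theta n)
  (fun s => (L n i s - moment1 n i) * (L n j s - moment1 n j)).
Proof.
transitivity (mean (histories theta n) (fun s => L n i s * L n j s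
  + (- moment1 n i) * L n j s + (- moment1 n j) * L n i s
  + moment1 n i * moment1 n j)); last first.
  by apply: eq_mean => s _; ring.
rewrite 3!meanD 2!meanZ mean_cst ?histories_gt0 //.
by rewrite /cov /moment2 /moment1; ring.
Qed.

Section step.
Variables (n : nat) (s : seq {fset nat}).
Hypothesis hs : s \in histories theta n.

Lemma history_sub A : A \in choices theta n -> forall k, (k <= n)%N ->
  (nth fset0 (rcons s A) k `<=` vertices theta k)%fset.
Proof.
move=> An k kn.
have hk : (k < n.+1)%N by [].
(* The extended list is a history of length [n.+1], which covers all indices up to [n] at once. *)
have sA : rcons s A \in histories theta n.+1.
  by apply/allpairsP; exists (s, A).
by have := nth_history sA hk; rewrite choicesE in_draws => /andP[].
Qed.

Lemma level_rcons A i : level theta (nth fset0 (rcons s A)) n i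
  = level theta (nth fset0 s) n i.
Proof.
by apply: eq_level => k kn; rewrite nth_rcons (size_history hs) kn.
Qed.

Lemma nth_rcons_history (A : {fset nat}) : nth fset0 (rcons s A) n = A.
Proof. by rewrite nth_rcons (size_history hs) ltnn eqxx. Qed.

Lemma level_size1S A : A \in choices theta n ->
  L n.+1 1 (rcons s A) = J n 1 s A + 1.
Proof.
move=> /history_sub/card_level1S; rewrite /level_size => ->.
by rewrite level_rcons nth_rcons_history -natr1.
Qed.

Lemma level_size2S A : A \in choices theta n ->
  L n.+1 2 (rcons s A) = J n 2 s A + L n 1 s - J n 1 s A.
Proof.
move=> /history_sub/card_level2S/(congr1 (fun k => k%:R : R)).
rewrite !natrD !level_rcons nth_rcons_history -/(J n 1 s A) -/(J n 2 s A).
by rewrite -/(L n 1 s) -/(L n.+1 2 (rcons s A)) => <-; rewrite addrK.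
Qed.

Let theta_lt : (theta.-1 < #|` vertices theta n|)%N.
Proof.
by rewrite card_vertices prednK ?leq_addl // (leq_trans _ theta_ge2).
Qed.

Lemma mean_unhit i : mean (choices theta n) (J n i s) = q1 n * L n i s.
Proof.
by rewrite choicesE mean_draws_cardD ?level_sub // card_vertices.
Qed.

(** Distinct levels are disjoint, so the diagonal contribution survives only for [i = j]. *)
Lemma mean_unhitM i j : mean (choices theta n) (fun A => J n i s A * J n j s A)
  = q2 n * (L n i s * L n j s) + (i == j)%:R * ((q1 n - q2 n) * L n i s).
Proof.
rewrite choicesE mean_draws_cardDM ?level_sub // card_vertices.
case: eqVneq => [<-|ij]; first by rewrite fsetIid mul1r.
by rewrite level_disjoint // cardfs0 mulr0 mul0r.
Qed.

End step.

Lemma moment1_1S n : moment1 n.+1 1 = q1 n * moment1 n 1 + 1.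
Proof.
rewrite /moment1 mean_historiesS.
transitivity (mean (histories theta n) (fun s => q1 n * L n 1 s + 1)).
  apply: eq_mean => s hs.
  rewrite (@eq_mean _ _ _ _ (fun A => J n 1 s A + 1)); last first.
    by move=> A An; exact: level_size1S.
  by rewrite meanD mean_unhit mean_cst ?choices_gt0.
by rewrite meanD meanZ mean_cst ?histories_gt0.
Qed.

Lemma moment1_2S n :
  moment1 n.+1 2 = q1 n * moment1 n 2 + (1 - q1 n) * moment1 n 1.
Proof.
rewrite /moment1 mean_historiesS.
transitivity (mean (histories theta n)
    (fun s => q1 n * L n 2 s + (1 - q1 n) * L n 1 s)).
  apply: eq_mean => s hs.
  rewrite (@eq_mean _ _ _ _ (fun A => J n 2 s A + L n 1 s - J n 1 s A)); last first.
    by move=> A An; exact: level_size2S.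
  by rewrite meanB meanD !mean_unhit mean_cst ?choices_gt0 //; ring.
by rewrite meanD !meanZ.
Qed.

Lemma moment2_11S n : moment2 n.+1 1 1
  = q2 n * moment2 n 1 1 + (3 * q1 n - q2 n) * moment1 n 1 + 1.
Proof.
rewrite /moment2 mean_historiesS.
transitivity (mean (histories theta n) (fun s =>
    q2 n * (L n 1 s * L n 1 s) + (3 * q1 n - q2 n) * L n 1 s + 1)).
  apply: eq_mean => s hs.
  rewrite (@eq_mean _ _ _ _ (fun A => J n 1 s A * J n 1 s A + 2 * J n 1 s A + 1)).
    by rewrite !meanD meanZ mean_unhitM mean_unhit mean_cst ?choices_gt0 //=; ring.
  by move=> A An; rewrite level_size1S //; ring.
by rewrite !meanD !meanZ mean_cst ?histories_gt0.
Qed.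

Lemma moment2_12S n : moment2 n.+1 1 2
  = q2 n * moment2 n 1 2 + (q1 n - q2 n) * moment2 n 1 1
    + q1 n * moment1 n 2 + (1 - 2 * q1 n + q2 n) * moment1 n 1.
Proof.
rewrite /moment2 mean_historiesS.
transitivity (mean (histories theta n) (fun s =>
    q2 n * (L n 1 s * L n 2 s) + (q1 n - q2 n) * (L n 1 s * L n 1 s)
    + q1 n * L n 2 s + (1 - 2 * q1 n + q2 n) * L n 1 s)).
  apply: eq_mean => s hs.
  rewrite (@eq_mean _ _ _ _ (fun A => J n 1 s A * J n 2 s A
    + (L n 1 s - 1) * J n 1 s A - J n 1 s A * J n 1 s A + J n 2 s A + L n 1 s)).
    rewrite 2!meanD meanB meanD meanZ !mean_unhitM !mean_unhit.
    by rewrite mean_cst ?choices_gt0 //=; ring.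
  by move=> A An; rewrite level_size1S // level_size2S //; ring.
by rewrite !meanD !meanZ.
Qed.

Lemma moment2_22S n : moment2 n.+1 2 2
  = q2 n * moment2 n 2 2 + (1 + q2 n - 2 * q1 n) * moment2 n 1 1
    + 2 * (q1 n - q2 n) * moment2 n 1 2
    + (q1 n - q2 n) * (moment1 n 1 + moment1 n 2).
Proof.
rewrite /moment2 mean_historiesS.
transitivity (mean (histories theta n) (fun s =>
    q2 n * (L n 2 s * L n 2 s) + (1 + q2 n - 2 * q1 n) * (L n 1 s * L n 1 s)
    + 2 * (q1 n - q2 n) * (L n 1 s * L n 2 s) + (q1 n - q2 n) * (L n 1 s + L n 2 s))).
  apply: eq_mean => s hs.
  rewrite (@eq_mean _ _ _ _ (fun A => J n 2 s A * J n 2 s A + J n 1 s A * J n 1 s A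
    + 2 * L n 1 s * J n 2 s A - 2 * (J n 1 s A * J n 2 s A)
    - 2 * L n 1 s * J n 1 s A + L n 1 s * L n 1 s)).
    rewrite meanD 2!meanB 2!meanD !meanZ !mean_unhitM !mean_unhit.
    by rewrite mean_cst ?choices_gt0 //=; ring.
  by move=> A An; rewrite level_size2S //; ring.
by rewrite !meanD !meanZ meanD.
Qed.

(** Raw second moments grow like n^2 and are eliminated in favour of [cov]. Grouping by [q1 - q2]
    and [q2 - q1 ^+ 2], of orders 1/n and 1/n^2, gives each remaining term a finite limit. *)
Lemma cov11S n : cov n.+1 1 1 = q2 n * cov n 1 1
  + ((q2 n - q1 n ^+ 2) * moment1 n 1 * moment1 n 1 + (q1 n - q2 n) * moment1 n 1).
Proof. by rewrite /cov moment2_11S moment1_1S; ring. Qed.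

Lemma cov12S n : cov n.+1 1 2 = q2 n * cov n 1 2
  + ((q1 n - q2 n) * cov n 1 1
     + (q2 n - q1 n ^+ 2) * moment1 n 1 * moment1 n 2
     - ((q2 n - q1 n ^+ 2) * moment1 n 1 * moment1 n 1 + (q1 n - q2 n) * moment1 n 1)).
Proof. by rewrite /cov moment2_12S moment1_1S moment1_2S; ring. Qed.

Lemma cov22S n : cov n.+1 2 2 = q2 n * cov n 2 2
  + ((1 + q2 n - 2 * q1 n) * cov n 1 1 + 2 * ((q1 n - q2 n) * cov n 1 2)
     + (q2 n - q1 n ^+ 2) * moment1 n 1 * moment1 n 1
     + (q2 n - q1 n ^+ 2) * moment1 n 2 * moment1 n 2
     - 2 * ((q2 n - q1 n ^+ 2) * moment1 n 1 * moment1 n 2)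
     + (q1 n - q2 n) * moment1 n 1 + (q1 n - q2 n) * moment1 n 2).
Proof. by rewrite /cov moment2_22S moment1_2S; ring. Qed.

End moments.

(** * Linear recursions *)

Section linear_recursion.
Context {R : realType}.
Implicit Types (x r e : R^nat).

(* The error [z n = x n - n L] satisfies [z (n+1) = r n z n + eps n] with
   [eps n --> 0], so [|z n| / n] is bounded by the Cesaro means of [|eps|]. *)
Lemma cvg_linear_recursion x r e (c l : R) :
  (forall n, x n.+1 = r n * x n + e n) ->
  (forall n, 0 <= r n <= 1) ->
  n%:R * (1 - r n) @[n --> \oo] --> c ->
  e n @[n --> \oo] --> l ->
  1 + c != 0 ->
  n%:R^-1 * x n @[n --> \oo] --> l / (1 + c).
Proof.
move=> xS r01 rc el c1; set L := l / (1 + c).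
pose z n := x n - n%:R * L.
pose eps n := e n - L - (n%:R * (1 - r n)) * L.
have zS n : z n.+1 = r n * z n + eps n.
  by rewrite /z /eps xS -natr1; ring.
(* [L] is the solution of [l = L + c * L], which makes the limit of [eps] vanish. *)
have eps0 : `|eps n| @[n --> \oo] --> 0.
  rewrite -(@normr0 R R) (_ : 0 = l - L - c * L); last by rewrite /L; field.
  apply: cvg_norm; apply: cvgB; first exact: cvgB (cvg_cst _).
  exact: cvgMl.
have zle n : `|z n| <= `|z 0%N| + series (fun n => `|eps n|) n.
  elim: n => [|n IHn]; first by rewrite seriesEnat /= big_geq // addr0.
  rewrite zS seriesSr; apply: le_trans (ler_normD _ _) _.
  rewrite addrA lerD2r normrM; apply: le_trans IHn.
  case/andP: (r01 n) => r0 r1; rewrite ger0_norm // ler_piMl //.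
(* The shift avoids division by 0 and matches [harmonic] and [arithmetic_mean], both of which divide
   by [n.+1]. *)
rewrite -cvg_shiftS /=.
have -> : (fun n => n.+1%:R^-1 * x n.+1) = (fun n => L + n.+1%:R^-1 * z n.+1).
  by apply/funext => n; rewrite /z mulrBr mulrA mulVf ?pnatr_eq0 // mul1r; ring.
rewrite -[L in X in _ --> X]addr0; apply: cvgD; first exact: cvg_cst.
apply/norm_cvg0P.
apply: (@squeeze_cvgr _ _ _ _ (fun=> 0)
  (fun n => harmonic n * `|z 0%N| + arithmetic_mean (fun n => `|eps n|) n)).
- near=> n; rewrite normr_ge0 /= normrM ger0_norm ?invr_ge0 //.
  by rewrite -mulrDr ler_wpM2l ?invr_ge0.
- exact: cvg_cst.
- rewrite -[0]addr0; apply: cvgD; last exact: cesaro.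
  rewrite -[0](mul0r `|z 0%N|).
  by apply: cvgM; [exact: cvg_harmonic|exact: cvg_cst].
Unshelve. all: by end_near. Qed.

(** The factors [n] and [1/n] cancel except at [n = 0], which a limit ignores. Here [u] will be a
    coefficient decaying like 1/n and [v] a moment growing linearly. *)
Lemma cvg_mul_scaled (u v : R^nat) (a b : R) :
  n%:R * u n @[n --> \oo] --> a -> n%:R^-1 * v n @[n --> \oo] --> b ->
  u n * v n @[n --> \oo] --> a * b.
Proof.
move=> ua vb; apply: cvg_trans (cvgM ua vb).
apply: near_eq_cvg; near=> n.
have n0 : n%:R != 0 :> R by rewrite pnatr_eq0 -lt0n; near: n; exact: nbhs_infty_gt.
by rewrite /=; field.
Unshelve. all: by end_near. Qed.

Lemma cvg_inv_shift (a : nat) : (n + a.+1)%:R^-1 @[n --> \oo] --> (0 : R).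
Proof.
apply: (@squeeze_cvgr _ _ _ _ (fun=> 0) harmonic); last 2 first.
- exact: cvg_cst.
- exact: cvg_harmonic.
near=> n; rewrite invr_ge0 ler0n /= lef_pV2 ?posrE ?ltr0n ?addnS //.
by rewrite ler_nat ltnS leq_addr.
Unshelve. all: by end_near. Qed.

Lemma cvg_ratio (a b : nat) :
  (n + b)%:R / (n + a.+1)%:R @[n --> \oo] --> (1 : R).
Proof.
have -> : (fun n => (n + b)%:R / (n + a.+1)%:R)
        = (fun n => 1 - (a.+1%:R - b%:R) * (n + a.+1)%:R^-1) :> (nat -> R).
  apply/funext => n; have n0 : (n + a.+1)%:R != 0 :> R by rewrite pnatr_eq0 addnS.
  by move: n0; rewrite !natrD => n0; field.
rewrite [X in _ --> X](_ : 1 = 1 - (a.+1%:R - b%:R) * 0); last first.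
  by rewrite mulr0 subr0.
apply: cvgB; first exact: cvg_cst.
by apply: cvgM; [exact: cvg_cst|exact: cvg_inv_shift].
Qed.

End linear_recursion.

(** * Asymptotics of the moments *)

Section limits.
Context {R : realType}.
Variable theta : nat.
Hypothesis theta_ge2 : (2 <= theta)%N.

Let k : R := theta%:R - 1.
Let q1 n : R := miss1 (n + theta) theta.-1.
Let q2 n : R := miss2 (n + theta) theta.-1.

(** Since [n + theta - theta.-1 = n + 1], the truncated subtraction disappears; in [miss2E] the
    second factor likewise leaves [n]. Both forms are then open to [field]. *)
Lemma miss1E n : q1 n = (n + 1)%:R / (n + theta)%:R.
Proof.
rewrite /q1 /miss1; case: theta theta_ge2 => [|[|h]] // _.
by rewrite addnS subSS addnS -addSn addnK addn1.
Qed.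

Lemma miss2E n :
  q2 n = (n + 1)%:R / (n + theta)%:R * (n%:R / (n + theta.-1)%:R).
Proof.
rewrite /q2 /miss2; case: theta theta_ge2 => [|[|h]] // _ /=.
rewrite [(n + h.+2)%N]addnS /= subSS addnK addnS -addSn addnK addn1 !natrM invfM.
by ring.
Qed.

Lemma ratio_le1 (m p : nat) : (m <= p)%N -> 0 <= (m%:R / p%:R : R) <= 1.
Proof.
move=> mp; rewrite divr_ge0 //=; case: p mp => [|p] mp.
  by rewrite invr0 mulr0.
by rewrite ler_pdivrMr ?ltr0n // mul1r ler_nat.
Qed.

Lemma miss1_01 n : 0 <= q1 n <= 1.
Proof. by rewrite miss1E ratio_le1 // leq_add2l ltnW. Qed.

Lemma miss2_01 n : 0 <= q2 n <= 1.
Proof.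
have /andP[a0 a1] := miss1_01 n.
have /andP[b0 b1] := ratio_le1 (leq_addr theta.-1 n).
by rewrite miss2E -miss1E mulr_ge0 // mulr_ile1.
Qed.

Let r0 (n : nat) : R := n%:R / (n + theta)%:R.
Let r1 (n : nat) : R := n%:R / (n + theta.-1)%:R.

Let r0_cvg : r0 n @[n --> \oo] --> (1 : R).
Proof.
have := @cvg_ratio R theta.-1 0; rewrite prednK; last exact: ltnW.
by under eq_fun do rewrite addn0.
Qed.

Let r1_cvg : r1 n @[n --> \oo] --> (1 : R).
Proof.
have := @cvg_ratio R theta.-2 0; rewrite prednK; last first.
  by rewrite -ltnS prednK // ltnW.
by under eq_fun do rewrite addn0.
Qed.

Let q1_cvg : q1 n @[n --> \oo] --> (1 : R).
Proof.
have := @cvg_ratio R theta.-1 1; rewrite prednK; last exact: ltnW.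
by under eq_fun do rewrite -miss1E.
Qed.

Let pred_theta : (theta.-1)%:R = theta%:R - 1 :> R.
Proof. by rewrite -subn1 natrB // ltnW. Qed.

Let natr_neq0 n :
  n%:R + theta%:R != 0 :> R /\ n%:R + (theta%:R - 1) != 0 :> R.
Proof.
rewrite -pred_theta -!natrD !pnatr_eq0 !addn_eq0.
by move: theta_ge2; case: theta => [|[|h]] // _; rewrite !andbF.
Qed.

Lemma cvg_scaled_miss1 : n%:R * (1 - q1 n) @[n --> \oo] --> k.
Proof.
rewrite -[k]mulr1.
rewrite (_ : (fun n => _) = fun n => k * r0 n).
  by apply: cvgM; [exact: cvg_cst|exact: r0_cvg].
apply/funext => n; rewrite miss1E /r0 /k !natrD.
by have [h1 h2] := natr_neq0 n; field.
Qed.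

(** Exactly, [q1 n - q2 n = k * q1 n / (n + theta - 1)]. *)
Lemma cvg_scaled_miss12 : n%:R * (q1 n - q2 n) @[n --> \oo] --> k.
Proof.
rewrite -[k]mulr1 -[k * 1]mulr1.
rewrite (_ : (fun n => _) = fun n => k * q1 n * r1 n).
  by do 2 (apply: cvgM => //); exact: cvg_cst.
apply/funext => n; rewrite miss2E !miss1E /r1 /k !natrD pred_theta.
by have [h1 h2] := natr_neq0 n; field; rewrite h1 h2.
Qed.

Lemma cvg_scaled_miss2 : n%:R * (1 - q2 n) @[n --> \oo] --> 2 * k.
Proof.
rewrite (_ : (fun n => _) = fun n => n%:R * (1 - q1 n) + n%:R * (q1 n - q2 n)).
  rewrite mulr_natl mulr2n.
  by apply: cvgD; [exact: cvg_scaled_miss1|exact: cvg_scaled_miss12].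
by apply/funext => n; ring.
Qed.

(** Drawing without replacement correlates two misses negatively: exactly, [q2 n - q1 n ^+ 2 = - k *
    q1 n / ((n + theta) * (n + theta - 1))]. *)
Lemma cvg_scaled_miss_defect :
  n%:R * (n%:R * (q2 n - q1 n ^+ 2)) @[n --> \oo] --> - k.
Proof.
rewrite -[- k]mulr1 -[- k * 1]mulr1 -[- k * 1 * 1]mulr1.
rewrite (_ : (fun n => _) = fun n => - k * q1 n * r0 n * r1 n).
  by do 3 (apply: cvgM => //); exact: cvg_cst.
apply/funext => n; rewrite miss2E !miss1E /r1 /r0 /k !natrD pred_theta.
by have [h1 h2] := natr_neq0 n; field; rewrite h1 h2.
Qed.

Let k_gt0 : 0 < k.
Proof. by rewrite subr_gt0 ltr1n. Qed.

Let k1 : 1 + k != 0.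
Proof. by rewrite gt_eqF // addr_gt0. Qed.

Let k2 : 1 + 2 * k != 0.
Proof. by rewrite gt_eqF // addr_gt0 // mulr_gt0. Qed.

(** Each constant is the limit of the inhomogeneous term of its recursion divided by [1 + k] or
    [1 + 2 * k]. They are left unsimplified so as to match the recursions term by term; [cvg_cov]
    computes the closed forms. *)
Let a : R := 1 / (1 + k).
Let b : R := k * a / (1 + k).
Let s11 : R := (- k * a * a + k * a) / (1 + 2 * k).
Let s12 : R := (k * s11 + - k * a * b - (- k * a * a + k * a)) / (1 + 2 * k).
Let s22 : R := ((k - k) * s11 + 2 * (k * s12) + - k * a * a + - k * b * b
  - 2 * (- k * a * b) + k * a + k * b) / (1 + 2 * k).

Lemma cvg_moment1_1 : n%:R^-1 * moment1 theta n 1 @[n --> \oo] --> a.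
Proof.
apply: (@cvg_linear_recursion _ _ q1 (fun=> 1)) => //.
- exact: moment1_1S.
- exact: miss1_01.
- exact: cvg_scaled_miss1.
- exact: cvg_cst.
Qed.

Lemma cvg_moment1_2 : n%:R^-1 * moment1 theta n 2 @[n --> \oo] --> b.
Proof.
apply: (@cvg_linear_recursion _ _ q1 (fun n => (1 - q1 n) * moment1 theta n 1)) => //.
- exact: moment1_2S.
- exact: miss1_01.
- exact: cvg_scaled_miss1.
- apply: cvg_mul_scaled; [exact: cvg_scaled_miss1|exact: cvg_moment1_1].
Qed.

(** Each of the two linearly growing factors absorbs one power of [n], by one use of
    [cvg_mul_scaled]. *)
Let defect_cvg (u v : R^nat) (x y : R) :
  n%:R^-1 * u n @[n --> \oo] --> x -> n%:R^-1 * v n @[n --> \oo] --> y ->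
  (q2 n - q1 n ^+ 2) * u n * v n @[n --> \oo] --> - k * x * y.
Proof.
move=> ux; apply: cvg_mul_scaled.
under eq_fun do rewrite mulrA.
by apply: cvg_mul_scaled => //; exact: cvg_scaled_miss_defect.
Qed.

Let gap_cvg (u : R^nat) (x : R) : n%:R^-1 * u n @[n --> \oo] --> x ->
  (q1 n - q2 n) * u n @[n --> \oo] --> k * x.
Proof. by apply: cvg_mul_scaled; exact: cvg_scaled_miss12. Qed.

Lemma cvg_cov11 : n%:R^-1 * cov theta n 1 1 @[n --> \oo] --> s11.
Proof.
have m1 := cvg_moment1_1.
apply: (cvg_linear_recursion (cov11S theta_ge2) miss2_01 cvg_scaled_miss2) => //.
by apply: cvgD; [exact: defect_cvg|exact: gap_cvg].
Qed.

Lemma cvg_cov12 : n%:R^-1 * cov theta n 1 2 @[n --> \oo] --> s12.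
Proof.
have m1 := cvg_moment1_1; have m2 := cvg_moment1_2; have c11 := cvg_cov11.
apply: (cvg_linear_recursion (cov12S theta_ge2) miss2_01 cvg_scaled_miss2) => //.
apply: cvgB; apply: cvgD; by [exact: gap_cvg|exact: defect_cvg].
Qed.

Lemma cvg_cov22 : n%:R^-1 * cov theta n 2 2 @[n --> \oo] --> s22.
Proof.
have m1 := cvg_moment1_1; have m2 := cvg_moment1_2.
have c11 := cvg_cov11; have c12 := cvg_cov12.
apply: (cvg_linear_recursion (cov22S theta_ge2) miss2_01 cvg_scaled_miss2) => //.
do 2 (apply: cvgD; last exact: gap_cvg).
apply: cvgB; last by apply: cvgM; [exact: cvg_cst|exact: defect_cvg].
do 2 (apply: cvgD; last exact: defect_cvg).
apply: cvgD; last by apply: cvgM; [exact: cvg_cst|exact: gap_cvg].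
apply: cvg_mul_scaled => //.
(* The coefficient [1 + q2 - 2 * q1] is the difference of [1 - q1] and [q1 - q2], both equivalent to
   k/n; hence the limit [k - k] in [s22]. *)
rewrite (_ : (fun n => _) = fun n => n%:R * (1 - q1 n) - n%:R * (q1 n - q2 n)).
  by apply: cvgB; [exact: cvg_scaled_miss1|exact: cvg_scaled_miss12].
by apply/funext => n; rewrite /q1 /q2; ring.
Qed.

Lemma cvg_cov (i j : 'I_2) :
  n%:R^-1 * cov theta n i.+1 j.+1 @[n --> \oo] --> limit_matrix R theta i j.
Proof.
(* The denominators of the constants are [1 + k = theta] and [1 + 2 * k = 2 * theta - 1]. *)
have t0 : theta%:R != 0 :> R by move: k1; rewrite /k addrC subrK.
have t2 : 2 * theta%:R - 1 != 0 :> R.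
  by move: k2; rewrite /k (_ : 1 + _ = 2 * theta%:R - 1) //; ring.
have c21 : n%:R^-1 * cov theta n 2 1 @[n --> \oo] --> s12.
  rewrite (_ : (fun n => _) = fun n => n%:R^-1 * cov theta n 1 2).
    exact: cvg_cov12.
  apply/funext => n; congr (_ * _); rewrite /cov /moment2 mulrC.
  congr (mean _ _ - _).
  by apply/funext => s; rewrite mulrC.
(* The closed forms follow the order of the triangular system, each one substituting those already
   found. *)
have e11 : s11 = (theta%:R - 1) ^+ 2 / (theta%:R ^+ 2 * (2 * theta%:R - 1)).
  by rewrite /s11 /a /k; field; rewrite t0 t2.
have e12 : s12 = - ((theta%:R - 1) ^+ 2 * (theta%:R ^+ 2 + 2 * theta%:R - 1)
    / (theta%:R ^+ 3 * (2 * theta%:R - 1) ^+ 2)).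
  by rewrite /s12 e11 /b /a /k; field; rewrite t0 t2.
have e22 : s22 = (theta%:R - 1) ^+ 2 * (6 * theta%:R ^+ 4 - 6 * theta%:R ^+ 3
    + 8 * theta%:R ^+ 2 - 5 * theta%:R + 1)
    / (theta%:R ^+ 4 * (2 * theta%:R - 1) ^+ 3).
  by rewrite /s22 e11 e12 /b /a /k; field; rewrite t0 t2.
rewrite /limit_matrix mxE -e11 -e12 -e22.
case: i j => [[|[|//]] ?] [[|[|//]] ?] /=.
- exact: cvg_cov11.
- exact: cvg_cov12.
- exact: c21.
- exact: cvg_cov22.
Qed.

End limits.

(** * Transfer to the probability space and conclusion *)

Lemma covariance_matrixE (R : realType) (d : measure_display) (T : measurableType d)
    (P : probability T R) (theta : nat) (C : nat -> T -> {fset nat})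
    (treeC : hyperrecursive_tree P theta C) n i j :
  covariance_matrix P theta C n i j = cov theta n i.+1 j.+1.
Proof.
(* The counts at age [n] depend only on the first [n] choices, so they are functions of the past and
   [expectation_past] applies. *)
have XE l : X R theta C n l = fun w => level_size theta n l (past C n w).
  apply/funext => w; rewrite /X /level_size; congr (#|` _|%:R).
  apply: eq_level => m mn.
  by rewrite (nth_map 0%N) ?size_iota // nth_iota.
have EX l : fine ('E_P[X R theta C n l])%E = moment1 theta n l.
  by rewrite XE (expectation_past treeC n (level_size theta n l)).
rewrite mxE covariance.unlock !EX covE !XE.
by have /(congr1 fine) := expectation_past treeC n (fun s =>
  (level_size theta n i.+1 s - moment1 theta n i.+1) *
  (level_size theta n j.+1 s - moment1 theta n j.+1)).
Qed.

Theorem theorem5p1 (R : realType) (d : measure_display) (T : measurableType d)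
    (P : probability T R) (theta : nat) (C : nat -> T -> {fset nat})
    (theta_ge2 : (2 <= theta)%N) (treeC : hyperrecursive_tree P theta C)
    (i j : 'I_2) :
  (n%:R^-1 *: covariance_matrix P theta C n) i j @[n --> \oo]
    --> limit_matrix R theta i j.
Proof.
under eq_fun do rewrite mxE (covariance_matrixE treeC).
exact: cvg_cov.
Qed.
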